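(* For $j\ge0$ with binary expansion $j=\sum_{l=0}^{s}j_l2^l$, $j_l\in\{0,1\}$, let $$\eta_j=\theta_j=\exp\Big(i\pi\sum_{l=0}^{s}j_l2^{-l}\Big).$$ Then the intertwining sequence of $(\eta_j)_{j\ge0}$ and $(\theta_i)_{i\ge0}$ is a (bidimensional) Leja sequence for the closed unit bidisk $\overline{\mathbb{D}}^2$.
   Context: Order $\mathbb{N}^2$ ($0\in\mathbb{N}$) by $(k_1,l_1)\le(k_2,l_2)$ iff $k_1+l_1<k_2+l_2$, or $k_1+l_1=k_2+l_2$ and $k_1\ge k_2$; this enumerates $\mathbb{N}^2$ as $(k(1),l(1)),(k(2),l(2)),\ldots=(0,0),(1,0),(0,1),(2,0),(1,1),\ldots$. Put $e_j(z,w)=z^{k(j)}w^{l(j)}$. The intertwining sequence of $(\eta_k)_{k\ge0}$ and $(\theta_l)_{l\ge0}$ is $H_j=(\eta_{k(j)},\theta_{l(j)})$, $j\ge1$. For points $x_1,\ldots,x_N\in\mathbb{C}^2$, $VDM(x_1,\ldots,x_N)=\det[e_i(x_j)]_{1\le i,j\le N}$. A bidimensional Leja sequence for a compact $K\subset\mathbb{C}^2$ is a sequence $(H_j)_{j\ge1}$ of points of $K$ such that for all $N\ge1$, $|VDM(H_1,\ldots,H_N,H_{N+1})|=\sup_{(z,w)\in K}|VDM(H_1,\ldots,H_N,(z,w))|$ (the first point $H_1\in K$ being arbitrary). *)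

(* Defs.v *)
From HB Require Import structures.
From mathcomp Require Import all_boot all_order all_algebra.
From mathcomp Require Import zify complex.
From mathcomp Require Import all_classical all_reals all_analysis.

Set Implicit Arguments.
Unset Strict Implicit.
Unset Printing Implicit Defensive.

Import Order.TTheory GRing.Theory Num.Theory.

Local Open Scope classical_set_scope.
Local Open Scope ring_scope.
Local Open Scope complex_scope.

(* Monomials and points are indexed from 0: the j-th one, j >= 1, of the usual
   numbering has index j.-1 here. *)

Definition grlex_le (p q : nat * nat) : bool :=
  ((p.1 + p.2 < q.1 + q.2) || ((p.1 + p.2 == q.1 + q.2) && (q.1 <= p.1)))%N.

Definition grlex_succ (p : nat * nat) : nat * nat :=
  if p is (k.+1, l) then (k, l.+1) else (p.2.+1, 0%N).

(* The enumeration of nat * nat in increasing order for grlex_le; grlex_enum_le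
   and grlex_enum_surj below characterize it. *)
Definition grlex_enum (j : nat) : nat * nat := iter j grlex_succ (0, 0)%N.

Lemma grlex_le_refl p : grlex_le p p.
Proof. by rewrite /grlex_le eqxx leqnn orbT. Qed.

Lemma grlex_le_trans : transitive grlex_le.
Proof.
by move=> [a b] [c d] [e f]; rewrite /grlex_le /=; lia.
Qed.

Lemma grlex_succ_le p q : grlex_le (grlex_succ p) q = ~~ grlex_le q p.
Proof. by case: p q => [[|k] l] [c d]; rewrite /grlex_le /grlex_succ /=; lia. Qed.

Lemma grlex_le_enumS i : grlex_le (grlex_enum i) (grlex_enum i.+1).
Proof.
rewrite /grlex_enum /= /grlex_le; case: (iter _ _ _) => [[|k] l] /=.
  by rewrite add0n addn0 ltnSn.
by rewrite addSnnS eqxx ltnn leqnSn.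
Qed.

Lemma grlex_enum_le i j :
  grlex_le (grlex_enum i) (grlex_enum j) = (i <= j)%N.
Proof.
have mono : {homo grlex_enum : a b / (a <= b)%N >-> grlex_le a b}.
  exact: (homo_leq grlex_le_refl grlex_le_trans grlex_le_enumS).
case: leqP => [/mono //|ji]; apply/negbTE.
by rewrite -grlex_succ_le; exact: (mono j.+1 i ji).
Qed.

Lemma grlex_enum_surj p : exists j, grlex_enum j = p.
Proof.
case: p => k l; have [n] := ubnP (k + l)%N.
elim: n k l => // n IHn k l; elim: l k => [|l IHl] k; rewrite ltnS => h.
  case: k h => [_|k]; first by exists 0%N.
  rewrite addn0 => h; have [|j ej] := IHn 0%N k; first by rewrite add0n.
  by exists j.+1; rewrite /grlex_enum iterS -/(grlex_enum j) ej.
have [|j ej] := IHl k.+1; first by rewrite addSnnS ltnS.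
by exists j.+1; rewrite /grlex_enum iterS -/(grlex_enum j) ej.
Qed.

Definition binary_digit (j l : nat) : nat := odd (j %/ 2 ^ l).

(* For j > 0, trunc_log 2 j is the index of the leading binary digit of j;
   trunc_log 2 0 = 0. *)
Lemma binary_digitE j :
  j = (\sum_(l < (trunc_log 2 j).+1) binary_digit j l * 2 ^ l)%N.
Proof.
have H n : forall m, (m < 2 ^ n)%N ->
    m = (\sum_(l < n) binary_digit m l * 2 ^ l)%N.
  elim: n => [|n IHn] m; first by rewrite big_ord0 expn0 ltnS leqn0 => /eqP.
  rewrite expnS mul2n => hm.
  have hm2 : (m./2 < 2 ^ n)%N by rewrite ltn_half_double.
  rewrite big_ord_recl /binary_digit expn0 divn1 muln1.
  rewrite -[LHS]odd_double_half; congr (_ + _)%N.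
  rewrite [X in X.*2](IHn _ hm2) -mul2n big_distrr /=; apply: eq_bigr => i _.
  by rewrite /bump /= add1n expnS divnMA divn2 mulnCA.
by apply: H; exact: trunc_log_ltn.
Qed.

Section ComplexPlane2.
Variable R : realType.
Local Notation C := R[i].

Definition cexp (z : C) : C :=
  (expR (complex.Re z))%:C * (cos (complex.Im z) +i* sin (complex.Im z)).

Definition monom2 (j : nat) (p : C * C) : C :=
  p.1 ^+ (grlex_enum j).1 * p.2 ^+ (grlex_enum j).2.

Definition intertwining (eta theta : nat -> C) (j : nat) : C * C :=
  (eta (grlex_enum j).1, theta (grlex_enum j).2).

(* Only the first N points x 0, ..., x N.-1 are used. *)
Definition VDM (N : nat) (x : nat -> C * C) : C :=
  \det (\matrix_(i < N, j < N) monom2 i (x j)).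

(* Norms in R[i] are valued in R[i], hence the real-valued normc. The supremum
   is taken in \bar R, so that it is meaningful for every K. *)
Definition bidim_leja (K : set (C * C)) (H : nat -> C * C) : Prop :=
  (forall j, K (H j)) /\
  forall N, (1 <= N)%N ->
    (Normc.normc (VDM N.+1 H))%:E =
    ereal_sup [set (Normc.normc (VDM N.+1 [eta H with N |-> p]))%:E | p in K].

Definition closed_unit_disk : set C := [set z | `|z| <= 1].

End ComplexPlane2.
Arguments closed_unit_disk : clear implicits.

(* Main.v *)
(** Let [(k, l)] be the [N]-th exponent. The Vandermonde determinant of the
    first [N] intertwined points and [(z, w)] is, up to a factor independent of
    [(z, w)], the product of [P_k(z) = prod_(a < k) (z - eta_a)] and
    [Q_l(w) = prod_(b < l) (w - theta_b)], so everything reduces to the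
    one-dimensional Leja property of [eta].
    There, [eta_(2^s + r) = w_s eta_r] for [r < 2^s], with [w_s^(2^s) = -1];
    hence the first [2^s] points are the [2^s]-th roots of unity and
    [|P_(2^s + r)(z)| = |z^(2^s) - 1| |P_r(z / w_s)|]. On the disk the first
    factor is at most 2, the second is by induction at most [|P_r(eta_r)|], and
    both bounds are attained at [z = w_s eta_r]. *)

Require Import Defs.
From HB Require Import structures.
From mathcomp Require Import all_boot all_order all_algebra.
From mathcomp Require Import zify ring complex.
From mathcomp Require Import all_classical all_reals all_analysis.

Import Order.TTheory GRing.Theory Num.Theory.

Local Open Scope classical_set_scope.
Local Open Scope ring_scope.
Local Open Scope complex_scope.

(** * The graded order and boxes of exponents *)

Lemma grlex_enum_inj : injective grlex_enum.
Proof.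
move=> i j e; apply/eqP; rewrite eqn_leq -!grlex_enum_le e.
by rewrite grlex_le_refl.
Qed.

(** The graded order extends the componentwise order. *)
Lemma grlex_enum_box (j n : nat) :
  ((grlex_enum j).1 <= (grlex_enum n).1)%N ->
  ((grlex_enum j).2 <= (grlex_enum n).2)%N -> (j <= n)%N.
Proof.
rewrite -(grlex_enum_le j n) /grlex_le.
by case: (grlex_enum j) (grlex_enum n) => [a b] [c d] /=; lia.
Qed.

(** By [grlex_enum_box] the whole box occurs among the first [n.+1] exponents, so both sides sum
    over it, in different orders. *)
Lemma sum_grlex_box (V : nmodType) (n : nat) (F : nat * nat -> V) :
  (forall p, ~~ ((p.1 <= (grlex_enum n).1)%N && (p.2 <= (grlex_enum n).2)%N) ->
     F p = 0) ->
  \sum_(i < n.+1) F (grlex_enum i) =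
  \sum_(a < (grlex_enum n).1.+1) \sum_(b < (grlex_enum n).2.+1)
     F (nat_of_ord a, nat_of_ord b).
Proof.
move=> F0; set k := (grlex_enum n).1; set l := (grlex_enum n).2.
rewrite -(big_mkord xpredT (F \o grlex_enum)) -(big_map grlex_enum xpredT F).
rewrite -(big_rmcond _ _ F0) -big_filter.
rewrite -(big_mkord xpredT (fun a => \sum_(b < l.+1) F (a, nat_of_ord b))).
under [RHS]eq_bigr => a _ do rewrite -(big_mkord xpredT (fun b => F (a, b))).
rewrite -big_allpairs; apply: perm_big; apply: uniq_perm.
- by rewrite filter_uniq // map_inj_uniq ?iota_uniq //; exact: grlex_enum_inj.
- by apply: allpairs_uniq; rewrite ?iota_uniq // => -[a b] [c d] _ _ [-> ->].
move=> [a b]; rewrite mem_filter -/k -/l -[(_, _).1]/a -[(_, _).2]/b.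
apply/idP/allpairsP => [/andP[/andP[ak bl] _]|[[c d] [hc hd [-> ->]]]].
  by exists (a, b); rewrite !mem_index_iota /= !ltnS ak bl.
rewrite !mem_index_iota !ltnS in hc hd; rewrite (hc : c <= k)%N (hd : d <= l)%N.
have [j ej] := grlex_enum_surj (c, d); rewrite -ej.
by apply: map_f; rewrite mem_index_iota ltnS; apply: grlex_enum_box;
   rewrite ej.
Qed.

Definition node_poly {F : nzRingType} (e : nat -> F) (k : nat) : {poly F} :=
  \prod_(a < k) ('X - (e a)%:P).

Lemma size_node_poly (F : nzRingType) (e : nat -> F) k :
  size (node_poly e k) = k.+1.
Proof.
rewrite /node_poly -(big_mkord xpredT (fun a => 'X - (e a)%:P)).
by rewrite size_prod_XsubC size_iota subn0.
Qed.

Lemma node_poly_lead (F : nzRingType) (e : nat -> F) k :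
  (node_poly e k)`_k = 1.
Proof.
have := monic_prod_XsubC (index_enum 'I_k) xpredT (e \o @nat_of_ord k).
by move/monicP; rewrite lead_coefE -/(node_poly e k) size_node_poly.
Qed.

Lemma horner_node_poly (F : comNzRingType) (e : nat -> F) k z :
  (node_poly e k).[z] = \prod_(a < k) (z - e a).
Proof. by rewrite horner_prod; apply: eq_bigr => a _; rewrite hornerXsubC. Qed.

Lemma node_poly_root (F : comNzRingType) (e : nat -> F) k a :
  (a < k)%N -> (node_poly e k).[e a] = 0.
Proof.
by move=> ak; rewrite horner_node_poly (bigD1 (Ordinal ak)) //= subrr mul0r.
Qed.

(** * Factorization of the Vandermonde determinant *)

Section Factorization.
Variables (R : realType) (eta theta : nat -> R[i]) (N : nat).
Let P := node_poly eta (grlex_enum N).1.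
Let Q := node_poly theta (grlex_enum N).2.

(** The degrees of [P] and [Q] are the exponents of index [N], so only monomials in their box occur
    in the product. *)
Lemma node_poly_monom2 (p : R[i] * R[i]) :
  P.[p.1] * Q.[p.2] =
  \sum_(i < N.+1) P`_(grlex_enum i).1 * Q`_(grlex_enum i).2 * monom2 i p.
Proof.
pose F ab := P`_ab.1 * Q`_ab.2 * (p.1 ^+ ab.1 * p.2 ^+ ab.2).
rewrite -[RHS]/(\sum_(i < N.+1) F (grlex_enum i)) sum_grlex_box; last first.
  move=> ab; rewrite negb_and -!ltnNge /F => /orP[h|h].
    by rewrite [P`__]nth_default ?mul0r // size_node_poly.
  by rewrite [Q`__]nth_default ?(mulr0, mul0r) // size_node_poly.
rewrite (horner_coef_wide p.1 (leqnn _)) (horner_coef_wide p.2 (leqnn _)).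
rewrite !size_node_poly big_distrl; apply: eq_bigr => a _.
by rewrite big_distrr; apply: eq_bigr => b _; rewrite /F mulrACA.
Qed.

(* Adding to the last row of the Vandermonde matrix a combination of the others
   turns it into the values of [P(z) Q(w)], which vanishes at the first [N]
   points. *)
Lemma VDM_intertwining (p : R[i] * R[i]) :
  VDM N.+1 [eta intertwining eta theta with N |-> p] =
  P.[p.1] * Q.[p.2] * VDM N (intertwining eta theta).
Proof.
set x := (X in VDM _ X).
pose c (i : nat) := P`_(grlex_enum i).1 * Q`_(grlex_enum i).2.
pose M := \matrix_(i < N.+1, j < N.+1) monom2 i (x j).
pose T := \matrix_(i < N.+1, j < N.+1)
  (if i == ord_max then c j else (i == j)%:R).
(* [T] is lower triangular; its last diagonal entry is 1 because [P] and [Q] are monic. *)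
have detT : \det T = 1.
  rewrite det_trig; last first.
    apply/is_trig_mxP => i j ij; rewrite mxE ifF; last first.
      by apply/eqP => im; move: ij (ltn_ord j); rewrite im /=; lia.
    by rewrite -(inj_eq val_inj) /= ltn_eqF.
  apply: big1 => i _; rewrite mxE eqxx; case: eqP => // ->.
  by rewrite /c /= !node_poly_lead mulr1.
have TM i j : (T *m M) i j =
    if i == ord_max then P.[(x j).1] * Q.[(x j).2] else monom2 i (x j).
  rewrite mxE; case: (eqVneq i ord_max) => [->|ni].
    by rewrite node_poly_monom2; apply: eq_bigr => l _; rewrite !mxE eqxx.
  rewrite (bigD1 i) //= big1 ?addr0 => [|l li].
    by rewrite !mxE (negPf ni) eqxx mul1r.
  by rewrite !mxE (negPf ni) eq_sym (negPf li) mul0r.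
rewrite /VDM -/M -[\det M]mul1r -detT -det_mulmx.
rewrite (expand_det_row _ ord_max) (bigD1 ord_max) //= big1 ?addr0; last first.
  move=> j nj; rewrite TM eqxx /x /= ifF; last first.
    by rewrite -[N in _ == N]/(val (@ord_max N)) (inj_eq val_inj) (negPf nj).
  have jN : (j < N)%N.
    by rewrite ltn_neqAle -ltnS ltn_ord andbT; apply: contraNneq nj => e;
       apply/eqP/val_inj.
  rewrite /intertwining /=.
  (* As [j < N], some exponent of index [j] is below that of index [N], which gives a root of [P] or
     [Q]. *)
  case: (ltnP (grlex_enum j).1 (grlex_enum N).1) => h1.
    by rewrite /P node_poly_root // !mul0r.
  case: (ltnP (grlex_enum j).2 (grlex_enum N).2) => h2.
    have -> : Q.[theta (grlex_enum j).2] = 0 by exact: node_poly_root.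
    by rewrite mulr0 mul0r.
  by move: (grlex_enum_box _ _ h1 h2); rewrite leqNgt jN.
rewrite TM eqxx /x /= eqxx; congr (_ * _).
rewrite /cofactor -signr_odd addnn odd_double expr0 mul1r; congr (\det _).
apply/matrixP => i j; rewrite !mxE.
have := TM (lift ord_max i) (lift ord_max j); rewrite !mxE => ->.
rewrite eq_sym (negPf (neq_lift _ _)) !lift_max /x /=.
by rewrite ltn_eqF.
Qed.

End Factorization.

(** * The one-dimensional Leja property *)

Section DyadicLeja.
Variables (F : numFieldType) (e w : nat -> F).
Hypothesis e0 : e 0 = 1.
Hypothesis eD : forall s r, (r < 2 ^ s)%N -> e (2 ^ s + r)%N = w s * e r.
Hypothesis wX : forall s, w s ^+ (2 ^ s) = -1.

Let w_neq0 s : w s != 0.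
Proof.
apply/eqP => w0; have /eqP := wX s.
by rewrite w0 expr0n expn_eq0 /= eq_sym oppr_eq0 oner_eq0.
Qed.

Let norm_w s : `|w s| = 1.
Proof.
apply/eqP; rewrite -(@pexpr_eq1 _ _ (2 ^ s)) ?expn_gt0 //.
by rewrite -normrX wX normrN1.
Qed.

Lemma dyadic_unity_root s a : (a < 2 ^ s)%N -> e a ^+ (2 ^ s) = 1.
Proof.
elim: s a => [|s IHs] a.
  by rewrite expn0 ltnS leqn0 => /eqP ->; rewrite e0 expr1n.
move=> as1; rewrite expnSr exprM.
have [/IHs ->|sa] := ltnP a (2 ^ s); first by rewrite expr1n.
have ra : (a - 2 ^ s < 2 ^ s)%N by move: as1; rewrite expnS; lia.
by rewrite -(subnKC sa) eD // exprMn wX IHs // mulr1 sqrrN expr1n.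
Qed.

(** Each node past the first [2 ^ s] is [w s * e a]; pull [w s] out of its factor. The case
    [r = 2 ^ s] serves the doubling in [node_poly_pow2]. *)
Lemma node_poly_rotate s r z : (r <= 2 ^ s)%N ->
  (node_poly e (2 ^ s + r)).[z] =
  (node_poly e (2 ^ s)).[z] * (w s ^+ r * (node_poly e r).[z / w s]).
Proof.
move=> rs; rewrite !horner_node_poly big_split_ord /=; congr (_ * _).
rewrite -[r in w s ^+ r]card_ord -prodr_const -big_split /=.
apply: eq_bigr => a _; rewrite eD ?(leq_trans _ rs) //.
by rewrite mulrBr mulrCA divff ?mulr1.
Qed.

Lemma node_poly_pow2 s z : (node_poly e (2 ^ s)).[z] = z ^+ (2 ^ s) - 1.
Proof.
elim: s z => [|s IHs] z.
  by rewrite horner_node_poly expn0 big_ord_recl big_ord0 mulr1 e0 expr1.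
(* The rotated half contributes [z ^+ (2 ^ s) + 1]. *)
rewrite expnS mul2n -addnn node_poly_rotate // !IHs wX exprMn exprVn wX.
rewrite exprD invrN1; ring.
Qed.

Lemma dyadic_leja k z : `|z| <= 1 ->
  `|(node_poly e k).[z]| <= `|(node_poly e k).[e k]|.
Proof.
elim/ltn_ind: k z => k IHk z z1.
case: (posnP k) => [->|k0]; first by rewrite /node_poly big_ord0 !hornerC.
have /andP[sk ks] := trunc_log_bounds (isT : 1 < 2)%N k0.
set s := trunc_log 2 k in sk ks.
have kE := subnKC sk; set r := (k - 2 ^ s)%N in kE.
have rs : (r < 2 ^ s)%N by move: ks; rewrite expnS /r; lia.
rewrite -kE !node_poly_rotate ?(ltnW rs) // !normrM.
apply: ler_pM => //.
  (* Since [e k ^+ (2 ^ s) = -1], the right-hand side is 2. *)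
  rewrite !node_poly_pow2 eD // exprMn wX dyadic_unity_root // mulr1.
  rewrite -opprD normrN -[1 + 1]/(2%:R) normr_nat.
  rewrite (le_trans (ler_normB _ _)) // normr1 normrX.
  by rewrite -[2]/(1 + 1) lerD2r exprn_ile1.
(* Here [e k / w s = e r], and [z / w s] stays in the disk. *)
rewrite ler_wpM2l // eD // mulrAC divff // mul1r.
apply: IHk; first exact: leq_trans rs sk.
by rewrite normrM normfV norm_w invr1 mulr1.
Qed.

Lemma dyadic_norm k : `|e k| = 1.
Proof.
apply/eqP; rewrite -(@pexpr_eq1 _ _ (2 ^ (trunc_log 2 k).+1)) ?expn_gt0 //.
by rewrite -normrX dyadic_unity_root ?normr1 // trunc_log_ltn.
Qed.

End DyadicLeja.

(** * Binary phases and the exponential *)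

Section Phase.
Variable R : realType.

(** The angle divided by pi, with a digit count independent of [j] so that the leading digit splits
    off easily. *)
Definition phase (n j : nat) : R :=
  \sum_(l < n) (binary_digit j l)%:R * 2 ^- l.

Lemma phase_wide m n j : (j < 2 ^ m)%N -> (m <= n)%N -> phase n j = phase m j.
Proof.
move=> jm mn.
rewrite /phase (big_ord_widen n (fun l => (binary_digit j l)%:R * 2 ^- l) mn).
rewrite [RHS]big_mkcond; apply: eq_bigr => l _; case: ltnP => // ml.
by rewrite /binary_digit divn_small ?mul0r // (leq_trans jm) // leq_exp2l.
Qed.

(** Adding [2 ^ s] sets digit [s] and keeps the lower ones, [2 ^ s] being an even multiple of
    [2 ^ l] for [l < s]. *)
Lemma phaseD s r : (r < 2 ^ s)%N ->
  phase s.+1 (2 ^ s + r) = 2 ^- s + phase s r.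
Proof.
move=> rs; rewrite /phase big_ord_recr /= addrC; congr (_ + _).
  by rewrite /binary_digit divnDl // divnn expn_gt0 divn_small // mul1r.
apply: eq_bigr => l _; congr (_%:R * _); rewrite /binary_digit.
rewrite divnDl ?dvdn_exp2l ?(ltnW (ltn_ord l)) // oddD.
rewrite -[X in (2 ^ X)%N](subnKC (ltn_ord l)) addSnnS expnD mulKn ?expn_gt0 //.
by rewrite expnS mul2n odd_double.
Qed.

Lemma cexp0 : cexp (0 : R[i]) = 1.
Proof. by rewrite /cexp /= expR0 cos0 sin0 mul1r. Qed.

Lemma cexp_imD (a b : R) :
  cexp ((a + b) *i) = cexp (a *i) * cexp (b *i).
Proof.
rewrite /cexp /= expR0 !mul1r cosD sinD.
by apply/eqP; rewrite eq_complex /= addrC [X in _ && (X == _)]addrC !eqxx.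
Qed.

Lemma cexp_imMn (a : R) n : cexp ((a *+ n) *i) = cexp (a *i) ^+ n.
Proof.
elim: n => [|n IHn]; first by rewrite mulr0n expr0 -[RHS]cexp0.
by rewrite mulrS cexp_imD IHn exprS.
Qed.

Lemma cexp_pi : cexp ((pi : R) *i) = -1.
Proof.
rewrite /cexp /= expR0 mul1r cospi sinpi.
by apply/eqP; rewrite eq_complex /= oppr0 !eqxx.
Qed.

End Phase.

Theorem corollary4 (R : realType) (eta theta : nat -> R[i])
  (eta_def : forall j : nat, eta j =
     cexp ((pi * \sum_(l < (trunc_log 2 j).+1)
                   (binary_digit j l)%:R * 2 ^- l) *i))
  (theta_def : forall j : nat, theta j = eta j) :
  bidim_leja (closed_unit_disk R `*` closed_unit_disk R)
             (intertwining eta theta).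
Proof.
(* Any sufficient number of digits will do, the extra ones being zero. *)
have etaE n j : (j < 2 ^ n)%N -> eta j = cexp ((pi * phase R n j) *i).
  move=> jn; rewrite eta_def -/(phase R _ j).
  have jt := trunc_log_ltn j (isT : 1 < 2)%N.
  case: (leqP n (trunc_log 2 j).+1) => h; first by rewrite (phase_wide _ n).
  by rewrite (phase_wide _ _ _ _ jt (ltnW h)).
pose w s : R[i] := cexp ((pi * 2 ^- s) *i).
have e0 : eta 0 = 1.
  by rewrite (etaE 0%N) // /phase big_ord0 mulr0 -[RHS]cexp0.
have eD s r : (r < 2 ^ s)%N -> eta (2 ^ s + r)%N = w s * eta r.
  move=> rs; rewrite (etaE s.+1) ?expnS ?mul2n -?addnn ?ltn_add2l //.
  by rewrite phaseD // mulrDr cexp_imD -etaE.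
have wX s : w s ^+ (2 ^ s) = -1.
  by rewrite -cexp_imMn -[_ *+ (2 ^ s)]mulr_natr natrX mulfVK ?cexp_pi.
have -> : theta = eta by apply/funext.
have norm1 := dyadic_norm _ _ _ e0 eD wX.
split=> [j|N _]; first by split; rewrite /closed_unit_disk /= norm1.
set H := intertwining eta eta.
(* This form makes [H N] a competitor in the supremum and lets [VDM_intertwining] apply to both
   sides. *)
have HN : VDM N.+1 H = VDM N.+1 [eta H with N |-> H N].
  congr (\det _); apply/matrixP => i j; rewrite !mxE /=.
  by case: eqP => // ->.
apply/eqP; rewrite HN eq_le; apply/andP; split.
  apply: ereal_sup_ubound; exists (H N) => //.
  by split; rewrite /closed_unit_disk /= norm1.
apply/ereal_supP => _ [p [p1 p2] <-].
have normcE (x : R[i]) : (Normc.normc x)%:C = `|x| by [].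
rewrite lee_fin -lecR !normcE !VDM_intertwining !normrM.
rewrite ler_wpM2r // ler_pM //.
  exact: (dyadic_leja _ _ _ e0 eD wX).
exact: (dyadic_leja _ _ _ e0 eD wX).
Qed.
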